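(* There is an example of a model (notation as in the context), with a discount factor $0<\gamma<1$, satisfying all of the following assumptions: 1. The step-size sequence of the Q-learning recursion is $\alpha_n=\min\{\alpha_0,n^{-\rho}\}$ with $\alpha_0>0$ and $1/2<\rho\le 1$. 2. The input $\{U_k:k\ge 0\}$ is i.i.d. on $\{0,1\}$ and independent of $\Phi=\{\Phi_k\}$. 3. There are functions $V:\mathsf X\to[0,\infty)$, $W:\mathsf X\to[1,\infty)$ and a constant $b>0$ such that $$\mathsf E\bigl[\exp(V(\Phi_{k+1}))\mid\Phi_k=x\bigr]\le\exp\bigl(V(x)-W(x)+b\bigr),\qquad x\in\mathsf X;$$ moreover, for each $r>0$ the set $S_W(r)=\{x\in\mathsf X: W(x)\le r\}$ is either small or empty, and $\sup\{V(x):x\in S_W(r)\}<\infty$. 4. $G=o(W)$, where $G(x)=\max_{u\in\{0,1\}}\bigl[\|\psi(g(x),u)\|^2+c(x,u)^2\bigr]$. 5. $R=\mathsf E_\varpi[\psi(\mathcal X_k,U_k)\psi(\mathcal X_k,U_k)^{\top}]$ has full rank (but the basis is not separable, i.e. it is not the case that $\psi^0_i(s)\psi^1_i(s)=0$ for every $s\in\mathsf S$ and every $i$), and for which the mean flow $\frac{d}{dt}\vartheta_t=\bar f(\vartheta_t)$, with $$\bar f(\theta)=\mathsf E_\varpi\Bigl[\psi(\mathcal X_k,U_k)\bigl\{-Q^\theta(\mathcal X_k,U_k)+c(\Phi_k,U_k)+\gamma(1-U_k)\,\underline Q^\theta(\mathcal X_{k+1})\bigr\}\Bigr],$$ is not stable,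 in the following sense: there is a unique root $\theta^*\in\mathbb R^d$ of $\bar f(\theta^* )=0$, yet for every initial condition $\vartheta_0\ne\theta^*$ the solution of the mean flow diverges to infinity.
   Context: Model. $\mathsf X,\mathsf Y$ are Polish spaces with Borel $\sigma$-algebras. $\Phi=\{\Phi_k:k\ge0\}$ is a time-homogeneous Markov chain on $\mathsf X$ with a unique invariant probability measure $\varpi$. Observations are $Y_k=h(\Phi_k)$ with $h:\mathsf X\to\mathsf Y$ measurable. The surrogate information state $\mathcal X_k=g(\Phi_k)$, with $g:\mathsf X\to\mathsf S$ measurable and $\mathsf S$ a subset of a Euclidean space, is adapted to the observations. Inputs $U_k$ take values in $\{0,1\}$. Cost functions $c_\circ,c_\bullet:\mathsf X\to\mathbb R$ are measurable, and $c(x,u)=(1-u)c_\circ(x)+u\,c_\bullet(x)$. $\mathsf E_\varpi$ (steady-state expectation) is the expectation when $\Phi_0\sim\varpi$. ''Small'' is in the usual sense of Meyn–Tweedie for the chain $\Phi$: a set $C$ is small if there are $m\ge1$, $\varepsilon>0$ and a probability measure $\nu$ with $P^m(x,A)\ge\varepsilon\nu(A)$ for all $x\in C$ and measurable $A$, where $P$ is the transition kernel. $G=o(W)$ means $\lim_{r\to\infty}\sup_{x}\frac{|G(x)|}{\max\{r,W(x)\}}=0$. Function class. $\psi(s,u)=u\psi^1(s)+(1-u)\psi^0(s)$ for $s\in\mathsf S$, $u\in\{0,1\}$, with $\psi^0,\psi^1:\mathsf S\to\mathbb R^d$ Borel measurable; $Q^\theta(s,u)=\theta^{\top}\psi(s,u)$,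 $\theta\in\mathbb R^d$; $\underline Q^\theta(s)=\min\{Q^\theta(s,0),Q^\theta(s,1)\}$. Q-learning recursion: $\theta_{n+1}=\theta_n+\alpha_{n+1}\psi(\mathcal X_n,U_n)\bigl[-Q^{\theta_n}(\mathcal X_n,U_n)+c(\Phi_n,U_n)+\gamma(1-U_n)\underline Q^{\theta_n}(\mathcal X_{n+1})\bigr]$; the mean flow is the ODE associated with it. *)

(* Defs.v *)
From HB Require Import structures.
From mathcomp Require Import all_boot all_order all_algebra.
From mathcomp Require Import all_classical all_reals all_analysis.

Set Implicit Arguments.
Unset Strict Implicit.
Unset Printing Implicit Defensive.

Import Order.TTheory GRing.Theory Num.Theory.
Import numFieldNormedType.Exports.

Local Open Scope classical_set_scope.
Local Open Scope ring_scope.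

(* A Hausdorff complete pseudometric is a complete metric. *)
Definition polish (R : realType) (T : completePseudoMetricType R) : Prop :=
  hausdorff_space T /\ exists2 D : set T, countable D & dense D.

Notation borel T := (g_sigma_algebraType (@open T)).

(* Stated without [measurable_fun] because a subset S of R^m is used below as
   a space in its own right, and [set_type S] need not be pointed. *)
Definition borel_fun (T T' : topologicalType) (f : T -> T') : Prop :=
  forall B : set T', <<s @open T' >> B -> <<s @open T >> (f @^-1` B).

Section processes.
Context d d' (Omega : measurableType d) (T : measurableType d').
Implicit Type Z : nat -> Omega -> T.

(* sigma(Z_0, ..., Z_k) *)
Definition history Z (k : nat) : set (set Omega) :=
  <<s \bigcup_(j in `I_k.+1) preimage_set_system setT (Z j) measurable >>.

(* sigma(Z_0, Z_1, ...) *)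
Definition sigma_process Z : set (set Omega) :=
  <<s \bigcup_j preimage_set_system setT (Z j) measurable >>.

Definition mutually_independent (R : realType) (P : probability Omega R) Z :
    Prop :=
  forall (J : seq nat) (A : nat -> set T), uniq J ->
    (forall j, measurable (A j)) ->
    P (\bigcap_(j in [set` J]) (Z j @^-1` A j)) =
    (\prod_(j <- J) P (Z j @^-1` A j))%E.

End processes.

Section kernels.
Context d (X : measurableType d) (R : realType) (P : R.-pker X ~> X).

Definition invariant (mu : probability X R) : Prop :=
  forall A, measurable A -> (\int[mu]_x P x A = mu A)%E.

Fixpoint kernel_iter (m : nat) (x : X) (A : set X) : \bar R :=
  if m is m'.+1 then (\int[P x]_y kernel_iter m' y A)%E else \d_x A.

Definition small (C : set X) : Prop :=
  measurable C /\
  exists (m : nat) (eps : R) (nu : probability X R),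
    [/\ (0 < m)%N, 0 < eps &
      forall x A, C x -> measurable A ->
        (eps%:E * nu A <= kernel_iter m x A)%E].

End kernels.

Section vectors.
Context (R : realType).

Definition enorm n (v : 'cV[R]_n) : R := Num.sqrt (\sum_i v i 0 ^+ 2).

(* Entrywise expectation of a random matrix; meaningful when the entries are
   integrable. *)
Definition expectation_mx d (Omega : measurableType d)
    (P : probability Omega R) m n (Z : Omega -> 'M[R]_(m, n)) : 'M[R]_(m, n) :=
  \matrix_(i, j) fine ('E_P[fun w => Z w i j])%E.

(* Solution of the autonomous ODE v' = f(v) on [0, +oo[ with v(0) = v0; the
   values of v at negative times are irrelevant. *)
Definition ode_solution n (f : 'cV[R]_n -> 'cV[R]_n) (v0 : 'cV[R]_n)
    (v : R -> 'cV[R]_n) : Prop :=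
  [/\ v 0 = v0,
      {within `[0, +oo[, continuous v} &
      forall t : R, 0 < t -> is_derive t 1 v (f (v t))].

Definition diverges n (v : R -> 'cV[R]_n) : Prop :=
  enorm (v t) @[t --> +oo] --> +oo.

(* G = o(W), with the supremum taken in the extended reals. *)
Definition little_o_of (T : Type) (G W : T -> R) : Prop :=
  ereal_sup (range (fun x : T => (`|G x| / Num.max r (W x))%:E))
    @[r --> +oo] --> 0%E.

End vectors.

(* [Prob mu] is the law under which Phi_0 ~ mu, so that E_varpi is
   the expectation under [Prob varpi]. *)
Record model (R : realType) := Model {
  Xspace : completePseudoMetricType R;
  Yspace : completePseudoMetricType R;
  Xspace_polish : polish Xspace;
  Yspace_polish : polish Yspace;
  trans : R.-pker (borel Xspace) ~> (borel Xspace);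
  varpi : probability (borel Xspace) R;
  varpi_invariant : invariant trans varpi;
  varpi_unique : forall mu : probability (borel Xspace) R, invariant trans mu ->
    forall A, measurable A -> mu A = varpi A;
  dOmega : measure_display;
  Omega : measurableType dOmega;
  Prob : probability (borel Xspace) R -> probability Omega R;
  Phi : nat -> Omega -> borel Xspace;
  Phi_measurable : forall k, measurable_fun setT (Phi k);
  Phi_init : forall mu A, measurable A -> Prob mu (Phi 0%N @^-1` A) = mu A;
  Phi_markov : forall mu k H A, history Phi k H -> measurable A ->
    (Prob mu (H `&` Phi k.+1 @^-1` A) =
     \int[Prob mu]_(w in H) trans (Phi k w) A)%E;
  (* observations Y_k = obs(Phi_k), surrogate state surrogate(Phi_k);
     Sset is the subset of the Euclidean space R^sdim in which it lives *)
  obs : borel Xspace -> borel Yspace;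
  obs_measurable : measurable_fun setT obs;
  sdim : nat;
  Sset : set 'cV[R]_sdim;
  surrogate : Xspace -> Sset;
  surrogate_measurable : borel_fun surrogate;
  surrogate_adapted : forall k (B : set Sset), <<s @open Sset >> B ->
    history (fun j w => obs (Phi j w)) k [set w | B (surrogate (Phi k w))];
  input : nat -> Omega -> bool;
  input_measurable : forall k, measurable_fun setT (input k);
  c_circ : borel Xspace -> R;
  c_bullet : borel Xspace -> R;
  c_circ_measurable : measurable_fun setT c_circ;
  c_bullet_measurable : measurable_fun setT c_bullet;
  discount : R;
  discount_gt0 : 0 < discount;
  discount_lt1 : discount < 1;
  bdim : nat;
  bdim_gt0 : (0 < bdim)%N;
  psi0 : Sset -> 'cV[R]_bdim;
  psi1 : Sset -> 'cV[R]_bdim;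
  psi0_measurable : borel_fun psi0;
  psi1_measurable : borel_fun psi1
}.

Arguments Sset {R} M _ : rename.
Arguments Phi {R} M k _ : rename.
Arguments input {R} M k _ : rename.

Section model_theory.
Context (R : realType) (M : model R).

Definition state (k : nat) (w : Omega M) : Sset M :=
  surrogate (Phi M k w : Xspace M).

Definition cost (x : Xspace M) (u : bool) : R :=
  (1 - u%:R) * c_circ x + u%:R * c_bullet x.

Definition psi (s : Sset M) (u : bool) : 'cV[R]_(bdim M) :=
  u%:R *: psi1 s + (1 - u%:R) *: psi0 s.

Definition Qfun (theta : 'cV[R]_(bdim M)) (s : Sset M) (u : bool) : R :=
  (theta^T *m psi s u) 0 0.

Definition Qmin (theta : 'cV[R]_(bdim M)) (s : Sset M) : R :=
  Num.min (Qfun theta s false) (Qfun theta s true).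

(* psi(X_k, U_k) times the temporal difference at time k *)
Definition update (k : nat) (theta : 'cV[R]_(bdim M)) (w : Omega M) :
    'cV[R]_(bdim M) :=
  (- Qfun theta (state k w) (input M k w) + cost (Phi M k w) (input M k w)
   + discount M * (1 - (input M k w)%:R) * Qmin theta (state k.+1 w))
  *: psi (state k w) (input M k w).

Definition q_learning (alpha : nat -> R)
    (theta : nat -> Omega M -> 'cV[R]_(bdim M)) : Prop :=
  forall n w,
    theta n.+1 w = theta n w + alpha n.+1 *: update n (theta n w) w.

(* Under [Prob varpi] the chain is stationary, so with i.i.d. inputs independent
   of it the choice k = 0 is immaterial, here and in [autocorrelation].  The
   entries are integrable as soon as [drift V W] and [little_o_of Gfun W]
   hold, because then the integral of W under varpi is at most b. *)
Definition mean_flow (theta : 'cV[R]_(bdim M)) : 'cV[R]_(bdim M) :=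
  expectation_mx (Prob (varpi M)) (update 0 theta).

Definition autocorrelation : 'M[R]_(bdim M) :=
  expectation_mx (Prob (varpi M))
    (fun w => let v := psi (state 0 w) (input M 0%N w) in v *m v^T).

(* Only alpha_n with n >= 1 enters the recursion. *)
Definition step_size (alpha : nat -> R) : Prop :=
  exists alpha0 rho : R, [/\ 0 < alpha0, 1 / 2 < rho, rho <= 1 &
    forall n, (0 < n)%N -> alpha n = Num.min alpha0 (n%:R `^ (- rho))].

Definition iid_input : Prop :=
  exists law : probability bool R, forall mu,
    [/\ forall k A, Prob mu (input M k @^-1` A) = law A,
        mutually_independent (Prob mu) (input M) &
        forall A B, sigma_process (input M) A -> sigma_process (Phi M) B ->
          (Prob mu (A `&` B) = Prob mu A * Prob mu B)%E].

Definition sublevel (W : Xspace M -> R) (r : R) : set (Xspace M) :=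
  [set x | W x <= r].

(* The conditional expectation given Phi_k = x is the integral against the
   transition kernel. *)
Definition drift (V W : Xspace M -> R) : Prop :=
  [/\ measurable_fun [set: borel (Xspace M)] V /\
      measurable_fun [set: borel (Xspace M)] W,
      (forall x, 0 <= V x) /\ (forall x, 1 <= W x),
      exists2 b : R, 0 < b & forall x : Xspace M,
        (\int[trans M x]_y (expR (V y))%:E <= (expR (V x - W x + b))%:E)%E &
      forall r : R, 0 < r ->
        (small (trans M) (sublevel W r) \/ sublevel W r = set0) /\
        has_ubound [set V x | x in sublevel W r]].

Definition Gfun (x : Xspace M) : R :=
  let Gu u := enorm (psi (surrogate x) u) ^+ 2 + cost x u ^+ 2 in
  Num.max (Gu false) (Gu true).

Definition separable_basis : Prop :=
  forall (s : Sset M) (i : 'I_(bdim M)), psi0 s i 0 * psi1 s i 0 = 0.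

(* Every solution from v0 is quantified over, together with existence of one,
   in place of "the" solution. *)
Definition unstable_mean_flow : Prop :=
  exists theta_star : 'cV[R]_(bdim M),
    [/\ mean_flow theta_star = 0,
        forall theta, mean_flow theta = 0 -> theta = theta_star &
        forall v0, v0 != theta_star ->
          (exists v, ode_solution mean_flow v0 v) /\
          (forall v, ode_solution mean_flow v0 v -> diverges v)].

End model_theory.

Arguments Gfun {R} M x : rename.

(* Main.v *)
(* The state s takes the values 1 and -1 and changes sign with probability
   1 - p; inputs are Bernoulli(p), p = 1/100, costs vanish, gamma = 1/2, d = 1,
   psi^0(s) = s and psi^1(s) = -10 s.  For theta > 0 the minimum defining
   \underline Q^theta(s) selects the coefficient -10 at s = 1 and -1 at s = -1;
   for theta < 0 it selects 1 at s = 1 and 10 at s = -1.  Both pairs differ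
   by 9, so after multiplication by psi^0 at the previous state, which mostly
   has the opposite sign, either one averages to (1 - 2 p) 9/2.  The mean flow
   is therefore linear, theta' = lambda theta, with
     lambda = gamma (1 - p) (1 - 2 p) 9/2 - 100 p - (1 - p) > 0.
   The coin flips driving the chain and the inputs are the events "the k-th
   digit in base 1/p vanishes" for two independent uniform points of [0, 1[. *)
Require Import Defs.
From HB Require Import structures.
From mathcomp Require Import all_boot all_order all_algebra.
From mathcomp Require Import all_classical all_reals all_analysis.
From mathcomp Require Import measurable_realfun ring lra.

Set Implicit Arguments.
Unset Strict Implicit.
Unset Printing Implicit Defensive.

Import Order.TTheory GRing.Theory Num.Theory.
Import numFieldNormedType.Exports.

Local Open Scope classical_set_scope.
Local Open Scope ring_scope.

(** * The two-point space as a Polish space *)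

Lemma bool_cauchy_cvg (F : set_system bool) :
  ProperFilter F -> cauchy F -> cvg F.
Proof.
(* The diagonal is an entourage of the discrete uniformity, so a Cauchy filter contains a set with
   at most one point. *)
move=> FF /(_ [set xy | xy.1 = xy.2]) [|[A B] /= [FA FB] AB].
  by rewrite uniform_discrete => z [x _ <-].
have [x Ax] := filter_ex FA.
apply/cvg_ex; exists x; apply/discrete_cvg.
apply: filterS FB => y By.
by have /= -> := AB (x, y) (conj Ax By).
Qed.

HB.instance Definition _ := Uniform_isComplete.Build bool bool_cauchy_cvg.

Lemma polish_bool (R : realType) :
  polish (bool : completePseudoMetricType R).
Proof.
split; last first.
  exists [set: bool]; [exact: countableP|by move=> O O0 _; rewrite setIT].
move=> x y; rewrite /cluster /= => /(_ [set x] [set y]).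
by move=> /(_ (discrete_set1 x) (discrete_set1 y)) [z [-> ->]].
Qed.

(** * Digits of a uniform random number *)

Section digits.
Context (R : realType) (N : nat).

(** The uniform law lives on the whole line, with the complement of [[0, 1[] as a null set, so digit
    functions may take arbitrary values there. *)
Definition unit_lebesgue : set (measurableTypeR R) -> \bar R :=
  mrestr (@lebesgue_measure R) (measurable_itv `[0, 1[).

HB.instance Definition _ := Measure.on unit_lebesgue.

Lemma unit_lebesgue_setT : unit_lebesgue setT = 1%E.
Proof.
rewrite /unit_lebesgue /mrestr setTI lebesgue_measure_itv/= lte_fin ltr01.
by rewrite oppr0 adde0.
Qed.

HB.instance Definition _ :=
  Measure_isProbability.Build _ _ _ unit_lebesgue unit_lebesgue_setT.

(** For [t] in [[0, 1[] this integer is spelled by the first [k] digits of [t] in base [N]. *)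
Definition prefix_num (k : nat) (t : R) : nat := Num.truncn (t * N%:R ^+ k).

(** Digits are numbered from 0, so digit [k] is the last one of the prefix of length [k.+1]. *)
Definition zero_digit (k : nat) (t : R) : bool :=
  (N %| prefix_num k.+1 t)%N.

Hypothesis N_gt0 : (0 < N)%N.

(** Euclidean division by [N] erases the last digit. *)
Lemma prefix_num_div k t : prefix_num k t = (prefix_num k.+1 t %/ N)%N.
Proof.
have N0 : 0 < N%:R :> R by rewrite ltr0n.
rewrite /prefix_num exprSr mulrA; set x := t * _.
(* For negative [x] both truncations are 0 by convention. *)
have [x0|x0] := leP 0 x; last first.
  have /truncn0Pn -> : ~~ (1 <= x) by rewrite -ltNge (lt_trans x0).
  suff /truncn0Pn -> : ~~ (1 <= x * N%:R) by rewrite div0n.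
  by rewrite -ltNge (lt_trans _ ltr01)// nmulr_rlt0.
have xN0 : 0 <= x * N%:R by rewrite mulr_ge0// ltW.
(* For [y >= 0] and a natural number [a], [a <= Num.truncn y] means [a <= y] in the reals; this
   yields both inequalities. *)
apply/eqP; rewrite eqn_leq leq_divRL// truncn_ge_nat// natrM.
rewrite ler_pM2r// truncn_le x0/= truncn_ge_nat//.
have := leq_trunc_div (Num.truncn (x * N%:R)) N.
rewrite -(ler_nat R) natrM => h.
by rewrite -(ler_pM2r N0) (le_trans h)// truncn_le.
Qed.

Lemma measurable_prefix_num k a :
  measurable ([set t | prefix_num k t = a] : set (measurableTypeR R)).
Proof.
have -> : [set t | prefix_num k t = a] =
   (fun t : measurableTypeR R => t * N%:R ^+ k) @^-1`
   [set x | Num.truncn x = a] by [].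
have mf : measurable_fun [set: measurableTypeR R]
    (fun t : measurableTypeR R => t * N%:R ^+ k).
  exact: mulrr_measurable.
rewrite -[X in measurable X]setTI; apply: mf => //.
(* Negative reals truncate to 0, hence the unbounded interval for [a = 0]. *)
suff -> : [set x : R | Num.truncn x = a] =
    if a is b.+1 then `[a%:R, a.+1%:R[%classic else `]-oo, 1[%classic.
  by case: a.
apply/seteqP; case: a => [|a]; split => x /=; rewrite in_itv/=.
- by move/truncn0Pn; rewrite -ltNge.
- by move=> x1; apply/truncn0Pn; rewrite -ltNge.
- move=> xa; rewrite -xa truncn_itv//.
  rewrite leNgt; apply/negP => x0; move: xa.
  by have /truncn0Pn -> : ~~ (1 <= x) by rewrite -ltNge (lt_trans x0).
- exact: truncn_def.
Qed.

Lemma prefix_num_unit k t : 0 <= t < 1 -> (prefix_num k t < N ^ k)%N.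
Proof.
move=> /andP[t0 t1]; rewrite /prefix_num truncn_lt_nat ?mulr_ge0 ?exprn_ge0//.
by rewrite natrX gtr_pMl// exprn_gt0// ltr0n.
Qed.

(** Prescribing the first [k] digits confines [t] to one interval of length [N ^- k]. *)
Lemma unit_lebesgue_prefix_num k a : (a < N ^ k)%N ->
  unit_lebesgue [set t | prefix_num k t = a] = ((N%:R : R) ^- k)%:E.
Proof.
move=> aN; rewrite /unit_lebesgue /mrestr.
have Nk0 : 0 < N%:R ^+ k :> R by rewrite exprn_gt0// ltr0n.
have -> : [set t | prefix_num k t = a] `&` `[0, 1[ =
    `[a%:R / N%:R ^+ k, a.+1%:R / N%:R ^+ k[%classic :> set R.
  apply/seteqP; split => t /=; rewrite !in_itv/=.
    move=> [/eqP + /andP[t0 t1]].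
    rewrite /prefix_num truncn_eq ?mulr_ge0 ?exprn_ge0//.
    by rewrite ler_pdivrMr// ltr_pdivlMr.
  rewrite ler_pdivrMr// ltr_pdivlMr// => at1; split.
    by apply: truncn_def.
  move: at1 => /andP[at0 at1].
  rewrite -(ler_pM2r Nk0) mul0r (le_trans _ at0)//=.
  rewrite -(ltr_pM2r Nk0) mul1r (lt_le_trans at1)//.
  by rewrite -natrX ler_nat.
rewrite lebesgue_measure_itv/= lte_fin ltr_pM2r ?invr_gt0// ltr_nat leqnn.
by rewrite -EFinB -mulrBl -natr1 addrAC subrr add0r mul1r.
Qed.

(** The set is, up to a null set, a disjoint union of digit intervals. The reindexing [h] serves
    twice, as the identity and as appending a zero digit; both measures then become sums over the
    same indices. *)
Lemma unit_lebesgue_prefix_set j k (h : nat -> nat) (S : set nat) :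
  injective h -> (forall a, (h a < N ^ k)%N = (a < N ^ j)%N) ->
  unit_lebesgue [set t | exists2 a, S a & prefix_num k t = h a] =
  (\sum_(a \in `I_(N ^ j) `&` S) ((N%:R : R) ^- k)%:E)%E.
Proof.
move=> hinj hN.
have finD : finite_set (`I_(N ^ j) `&` S).
  by apply: finite_setIl; exact: finite_II.
transitivity (unit_lebesgue (\bigcup_(a in `I_(N ^ j) `&` S)
   [set t | prefix_num k t = h a])).
  rewrite /unit_lebesgue /mrestr; congr (lebesgue_measure _).
  apply/seteqP; split => t /= [+ t01].
    move=> [a Sa kt]; split=> //; move: (t01); rewrite in_itv/= => t01'.
    by exists a => //; split=> //=; rewrite -hN -kt prefix_num_unit.
  by move=> [a [_ Sa] kt]; split=> //; exists a.
rewrite measure_fin_bigcup//.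
- apply: eq_fsbigr => a /set_mem [/= aN _].
  by rewrite unit_lebesgue_prefix_num// hN.
- by move=> a b _ _ [t [/= -> /hinj]].
- by move=> a _; exact: measurable_prefix_num.
Qed.

(** Appending a zero digit turns a prefix [a] into [a * N] and makes its interval [N] times shorter,
    whatever [a] is. *)
Lemma zero_digit_indep k (S : set nat) :
  unit_lebesgue [set t | S (prefix_num k t) /\ zero_digit k t] =
  (((N%:R : R)^-1)%:E * unit_lebesgue [set t | S (prefix_num k t)])%E.
Proof.
have -> : [set t | S (prefix_num k t) /\ zero_digit k t] =
    [set t | exists2 a, S a & prefix_num k.+1 t = (a * N)%N].
  apply/seteqP; split => t /=.
    move=> [St dt]; exists (prefix_num k t) => //.
    by rewrite (prefix_num_div k) divnK.
  move=> [a Sa ta]; rewrite (prefix_num_div k) /zero_digit ta mulnK//.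
  by rewrite dvdn_mull.
have -> : [set t | S (prefix_num k t)] =
    [set t | exists2 a, S a & prefix_num k t = id a].
  by apply/seteqP; split => t /= => [St|[a ? ->//]]; exists (prefix_num k t).
rewrite (@unit_lebesgue_prefix_set k k.+1 (muln^~ N)); last 2 first.
- by move=> a b /eqP; rewrite eqn_pmul2r// => /eqP.
- by move=> a; rewrite expnSr ltn_pmul2r.
rewrite (@unit_lebesgue_prefix_set k k id)//.
rewrite ge0_mule_fsumr; last first.
  by move=> a; rewrite lee_fin invr_ge0 exprn_ge0.
by apply: eq_fsbigr => a _; rewrite -EFinM exprSr invfM mulrC.
Qed.

(** Dividing by [N ^ (k - j.+1)] strips the digits after digit [j], so earlier digits can be read
    off a longer prefix. *)
Lemma zero_digit_prefix j k t : (j < k)%N ->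
  zero_digit j t = (N %| prefix_num k t %/ N ^ (k - j.+1))%N.
Proof.
move=> jk; rewrite /zero_digit; congr (_ %| _)%N.
(* Induction on the number of stripped digits, with [j.+1] written as [k] minus that number. *)
rewrite -{1}(subKn jk); elim: (k - j.+1)%N (leq_subr j.+1 k) => [|i IH] ik.
  by rewrite subn0 divn1.
rewrite prefix_num_div -subSn// subSS IH ?(ltnW ik)//.
by rewrite expnSr divnMA.
Qed.

End digits.

(** * Bernoulli processes *)

Section finite_valued.
Context d (T : measurableType d) (R : realType) (P : probability T R).
Context (V : finType) (X : T -> V).
Hypothesis mX : forall v, measurable [set t | X t = v].

Lemma probability_split (E : set T) : measurable E ->
  P E = (\sum_v P (E `&` [set t | X t = v]))%E.
Proof.
move=> mE; rewrite -[in LHS](setIT E).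
have -> : [set: T] = \bigcup_(v in [set: V]) [set t | X t = v].
  by apply/seteqP; split => t //= _; exists (X t).
rewrite setI_bigcupr measure_fin_bigcup//; first last.
- by move=> v _; exact: measurableI.
- by move=> u v _ _ [t [[_ /= <-] [_ /= <-]]].
- exact: finite_finset.
rewrite fsbig_finite; last exact: finite_finset.
apply: perm_big; apply: uniq_perm => [||v]; rewrite ?index_enum_uniq//.
by rewrite in_fset_set ?in_setT ?mem_index_enum//; exact: finite_finset.
Qed.

Lemma integral_finite_valued (D : set T) (g : V -> R) : measurable D ->
  (\int[P]_(t in D) (g (X t))%:E =
   \sum_v (g v)%:E * P (D `&` [set t | X t = v]))%E.
Proof.
move=> mD.
transitivity (\int[P]_(t in D)
    \sum_v ((g v)%:E * (\1_[set t | X t = v] t)%:E))%E.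
  apply: eq_integral => t _; rewrite (bigD1 (X t))//= indicE mem_set//= mule1.
  rewrite big1 ?adde0// => v vX; rewrite indicE memNset ?mule0//=.
  by move=> Xv; rewrite Xv eqxx in vX.
have intX v : P.-integrable D (fun t => (\1_[set t | X t = v] t)%:E).
  apply: (integrableS _ mD (@subsetT _ D)) => //.
  by apply: integrable_indic.
rewrite integral_sum//; last by move=> v; exact: integrableZl.
apply: eq_bigr => v _; rewrite integralZl// integral_indic//.
by rewrite setIC.
Qed.

End finite_valued.

Section bernoulli_process.
Context d (T : measurableType d) (R : realType) (Q : probability T R) (p : R).
Context (Z : nat -> T -> bool).

Definition outcomes (k : nat) (t : T) : seq bool := mkseq (Z^~ t) k.

(** Each trial succeeds with probability [p] independently of its strict past [Z 0], ..., [Z k.-1].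
    Past events are arbitrary sets of bit sequences, since only finitely many sequences have length
    [k]. Full mutual independence is derived from this. *)
Definition bernoulli_process : Prop :=
  (forall k, measurable [set t | Z k t]) /\
  forall k (S : set (seq bool)),
    Q [set t | S (outcomes k t) /\ Z k t] =
    (p%:E * Q [set t | S (outcomes k t)])%E.

Hypothesis HZ : bernoulli_process.

Lemma measurable_bernoulli_process k b : measurable [set t | Z k t = b].
Proof.
have mZ := HZ.1 k; case: b => //.
have -> : [set t | Z k t = false] = ~` [set t | Z k t].
  by apply/seteqP; split => t /=; case: (Z k t).
exact: measurableC.
Qed.

Lemma measurable_outcomes k (S : set (seq bool)) :
  measurable [set t | S (outcomes k t)].
Proof.
elim: k S => [|k IH] S.
  have [S0|S0] := pselect (S [::]).
    by rewrite (_ : [set t | _] = setT)//; apply/seteqP; split.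
  by rewrite (_ : [set t | _] = set0)//; apply/seteqP; split.
have -> : [set t | S (outcomes k.+1 t)] =
    \bigcup_(b in [set: bool]) ([set t | S (rcons (outcomes k t) b)] `&`
                               [set t | Z k t = b]).
  apply/seteqP; split => t /=; rewrite /outcomes mkseqS.
    by exists (Z k t).
  by move=> [b _ [/= Sb Zb]]; rewrite Zb.
apply: fin_bigcup_measurable => // b _; apply: measurableI.
  exact: (IH [set s | S (rcons s b)]).
exact: measurable_bernoulli_process.
Qed.

(** Success is the defining property; failure follows by subtracting it from the finite probability
    of the past event. *)
Lemma outcomes_indep k (S : set (seq bool)) b :
  Q [set t | S (outcomes k t) /\ Z k t = b] =
  ((bernoulli_pmf p b)%:E * Q [set t | S (outcomes k t)])%E.
Proof.
case: b; first exact: HZ.2.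
have mS := measurable_outcomes k S.
have := probability_split Q (measurable_bernoulli_process k) mS.
rewrite big_bool /= => H.
have fS : Q [set t | S (outcomes k t)] \is a fin_num by rewrite fin_num_measure.
have E : Q ([set t | S (outcomes k t)] `&` [set t | Z k t = true]) =
   (p%:E * Q [set t | S (outcomes k t)])%E := HZ.2 k S.
rewrite E in H.
have -> : [set t | S (outcomes k t) /\ Z k t = false] =
  [set t | S (outcomes k t)] `&` [set t | Z k t = false] by [].
set F := Q (_ `&` _) in H *.
have : F = (Q [set t | S (outcomes k t)] -
            p%:E * Q [set t | S (outcomes k t)])%E.
  by rewrite [in X in _ = (X - _)%E]H addeAC subee ?add0e// fin_numM.
by move->; rewrite /bernoulli_pmf EFinB muleBl// mul1e.
Qed.

Lemma bernoulli_process_law k b :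
  Q [set t | Z k t = b] = (bernoulli_pmf p b)%:E.
Proof.
have := outcomes_indep k setT b.
rewrite (_ : [set t | _ /\ _] = [set t | Z k t = b]); last first.
  by apply/seteqP; split => t /=; [case|].
by rewrite (_ : [set t | setT _] = setT)// probability_setT mule1.
Qed.

Lemma measurable_bernoulli_process_set k (B : set bool) :
  measurable [set t | B (Z k t)].
Proof.
have -> : [set t | B (Z k t)] = \bigcup_(b in B) [set t | Z k t = b].
  by apply/seteqP; split => t /= => [Bt|[b Bb ->//]]; exists (Z k t).
apply: fin_bigcup_measurable => // b _.
exact: measurable_bernoulli_process.
Qed.

Lemma outcomes_indep_set k (S : set (seq bool)) (B : set bool) :
  Q [set t | S (outcomes k t) /\ B (Z k t)] =
  (Q [set t | S (outcomes k t)] * Q [set t | B (Z k t)])%E.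
Proof.
have mS := measurable_outcomes k S.
have mB := measurable_bernoulli_process_set k B.
have mZ := measurable_bernoulli_process k.
rewrite (probability_split Q mZ) ?(probability_split Q mZ mB)//; last first.
  exact: measurableI.
rewrite ge0_sume_distrr//; apply: eq_bigr => b _.
have [Bb|Bb] := pselect (B b).
  rewrite (_ : _ `&` _ = [set t | S (outcomes k t) /\ Z k t = b]); last first.
    by apply/seteqP; split => t /= => [[[? ?] ?]|[? E]]; [|rewrite E].
  rewrite (_ : [set t | B (Z k t)] `&` _ = [set t | Z k t = b]); last first.
    by apply/seteqP; split => t /= => [[]//|E]; rewrite E.
  by rewrite outcomes_indep bernoulli_process_law muleC.
rewrite (_ : _ `&` _ = set0); last first.
  by apply/seteqP; split => t //= [[_ +] E]; rewrite E.
rewrite (_ : [set t | B (Z k t)] `&` _ = set0); last first.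
  by apply/seteqP; split => t //= [+ E]; rewrite E.
by rewrite measure0 mule0.
Qed.

(** Induction on [n]: the conditions on the first [n] trials form an event of the past, independent
    of trial [n]. *)
Lemma bernoulli_process_product n (A : nat -> set bool) :
  Q [set t | forall j, (j < n)%N -> A j (Z j t)] =
  (\prod_(j < n) Q [set t | A j (Z j t)])%E.
Proof.
elim: n => [|n IH].
  rewrite big_ord0 (_ : [set t | _] = setT) ?probability_setT//.
  by apply/seteqP; split.
rewrite big_ord_recr/= -IH.
pose S := [set s : seq bool | forall j, (j < n)%N -> A j (nth false s j)].
have SE : [set t | forall j, (j < n)%N -> A j (Z j t)] =
    [set t | S (outcomes n t)].
  by apply/seteqP; split => t /= H j jn; have := H j jn; rewrite nth_mkseq.
rewrite SE -outcomes_indep_set; congr (Q _); apply/seteqP; split => t /=.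
  move=> H; split; last exact: H.
  by move=> j jn; rewrite nth_mkseq//; apply: H; exact: ltnW.
move=> [H An] j; rewrite ltnS leq_eqVlt => /predU1P[->//|jn].
by have := H j jn; rewrite nth_mkseq.
Qed.

Lemma bernoulli_process_independent : mutually_independent Q Z.
Proof.
move=> J A Ju mA.
pose n := (\max_(j <- J) j).+1.
have Jn j : j \in J -> (j < n)%N.
  by move=> jJ; rewrite ltnS; apply: (leq_bigmax_seq j).
(* Padding [J] with sure events to an initial segment of the integers makes the product formula
   applicable. *)
pose B j := if j \in J then A j else setT.
have -> : \bigcap_(j in [set` J]) (Z j @^-1` A j) =
    [set t | forall j, (j < n)%N -> B j (Z j t)].
  apply/seteqP; split => t /= H j; rewrite /B.
    by move=> _; case: ifPn => // jJ; exact: H.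
  by move=> jJ; have := H j (Jn _ jJ); rewrite /B jJ.
rewrite bernoulli_process_product.
rewrite -(big_mkord xpredT (fun j => Q [set t | B j (Z j t)])).
rewrite (bigID (mem J))/= [X in (_ * X)%E]big1 ?mule1; last first.
  move=> j jJ; rewrite /B (negbTE jJ) (_ : [set t | _] = setT)//.
  exact: probability_setT.
rewrite -big_filter (perm_big J); last first.
  apply: uniq_perm => [||j] //; first exact/filter_uniq/iota_uniq.
  rewrite mem_filter mem_index_iota/=.
  by apply/andP/idP => [[]//|jJ]; rewrite Jn.
by apply: eq_big_seq => j jJ; rewrite /B jJ.
Qed.

End bernoulli_process.

Lemma zero_digit_bernoulli (R : realType) (N : nat) : (0 < N)%N ->
  bernoulli_process (@unit_lebesgue R) N%:R^-1 (@zero_digit R N).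
Proof.
move=> N0; split.
  move=> k.
  have -> : [set t | zero_digit N k t] =
     \bigcup_(a in [set a | N %| a]%N) [set t : R | prefix_num N k.+1 t = a].
    apply/seteqP; split => t /=; first by exists (prefix_num N k.+1 t).
    by move=> [a /= Na]; rewrite /zero_digit => ->.
  by apply: bigcup_measurable => a _; exact: measurable_prefix_num.
move=> k S.
(* The past outcomes are a function [f] of the prefix, so past events are prefix events, from which
   the next digit is independent. *)
pose f a := mkseq (fun j => N %| a %/ N ^ (k - j.+1))%N k.
have -> : @outcomes _ (measurableTypeR R) (@zero_digit R N) k =
    f \o prefix_num N k.
  apply/funext => t; apply/eq_in_map => j; rewrite mem_iota add0n/= => jk.
  exact: zero_digit_prefix.
exact: (zero_digit_indep _ N0 k (S \o f)).
Qed.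

(** * The transition kernel *)

Section flip_chain.
Context d (T : measurableType d) (R : realType) (Q : probability T R) (p : R).
Context (Z : nat -> T -> bool).
Hypothesis HZ : bernoulli_process Q p Z.

Local Notation X := (bool : completePseudoMetricType R).
Local Notation bX := (borel X).

Lemma measurable_borel_bool (A : set bX) : measurable A.
Proof. by apply: sub_sigma_algebra; exact: discrete_open. Qed.

Lemma measurable_fun_borel_bool d' (T' : measurableType d') (f : bX -> T') :
  measurable_fun setT f.
Proof. by move=> _ B _; exact: measurable_borel_bool. Qed.

Definition step (x z : bool) : bool := if z then x else ~~ x.

(** This names a map from [bool], with its own measurable structure, to the Borel space of states,
    so that the Bernoulli law can be pushed forward along it. *)
Definition to_borel (f : bool -> bool) : bool -> bX := f.

Lemma measurable_to_borel f : measurable_fun setT (to_borel f).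
Proof. by []. Qed.

HB.instance Definition _ f := isMeasurableFun.Build _ _ _ _ (to_borel f)
  (@measurable_to_borel f).

Definition flip_kernel (x : bX) : {measure set bX -> \bar R} :=
  distribution (bernoulli_prob p) (to_borel (step x)).

HB.instance Definition _ := isKernel.Build _ _ _ _ _ flip_kernel
  (fun A _ => @measurable_fun_borel_bool _ _ (flip_kernel ^~ A)).

Lemma flip_kernel_setT x : flip_kernel x setT = 1%E.
Proof.
exact: (probability_setT (distribution (bernoulli_prob p) (to_borel (step x)))).
Qed.

HB.instance Definition _ := Kernel_isProbability.Build _ _ _ _ _ flip_kernel
  flip_kernel_setT.

Definition unif_bool : probability bX R :=
  distribution (bernoulli_prob (2^-1 : R)) (to_borel id).

Lemma bernoulli_process_param : 0 <= p <= 1.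
Proof.
have := bernoulli_process_law HZ 0 true => /= E.
rewrite -!lee_fin -E measure_ge0 probability_le1//.
exact: measurable_bernoulli_process HZ _ _.
Qed.

Lemma flip_kernelE x A : flip_kernel x A =
  (p * \1_A (x : bX) + (1 - p) * \1_A (~~ x : bX))%:E.
Proof.
transitivity (bernoulli_prob p (step x @^-1` A)) => //.
by rewrite bernoulli_probE ?bernoulli_process_param.
Qed.

Lemma unif_boolE A : unif_bool A =
  (2^-1 * \1_A (true : bX) + 2^-1 * \1_A (false : bX))%:E.
Proof.
transitivity (bernoulli_prob (2^-1 : R) (id @^-1` A)) => //.
rewrite bernoulli_probE; last by apply/andP; split; lra.
transitivity
  ((2^-1 * \1_A (true : bX) + (1 - 2^-1) * \1_A (false : bX) : R)%:E) => //.
by congr (_ + _ * _)%:E; lra.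
Qed.

Lemma borel_bool_split (mu : probability bX R) A :
  mu A = (mu [set true] * (\1_A (true : bX))%:E +
          mu [set false] * (\1_A (false : bX))%:E)%E.
Proof.
have := @probability_split _ _ _ mu _ id (fun=> measurable_borel_bool _) A
  (measurable_borel_bool _).
rewrite big_bool => ->; congr (_ + _)%E.
  have [At|At] := pselect (A true).
    rewrite indicE mem_set// mule1; congr (mu _).
    by apply/seteqP; split => x /= => [[]|->].
  rewrite indicE memNset// mule0 -(measure0 mu); congr (mu _).
  by apply/seteqP; split => x //= => [[+ E]]; rewrite E.
have [At|At] := pselect (A false).
  rewrite indicE mem_set// mule1; congr (mu _).
  by apply/seteqP; split => x /= => [[]|->].
rewrite indicE memNset// mule0 -(measure0 mu); congr (mu _).
by apply/seteqP; split => x //= => [[+ E]]; rewrite E.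
Qed.

Lemma integral_borel_bool (mu : probability bX R) (g : bool -> R) :
  (\int[mu]_x (g x)%:E =
   (g true)%:E * mu [set true] + (g false)%:E * mu [set false])%E.
Proof.
have := @integral_finite_valued _ _ _ mu _ id (fun=> measurable_borel_bool _)
  setT g measurableT.
by rewrite big_bool !setTI => <-.
Qed.

Lemma borel_bool_fin (mu : probability bX R) A : mu A \is a fin_num.
Proof. by rewrite fin_num_measure//; exact: measurable_borel_bool. Qed.

Lemma indic_borel_bool1 (a b : bool) :
  \1_[set (a : bX)] (b : bX) = (b == a)%:R :> R.
Proof.
rewrite indicE; have [->|ba] := eqVneq b a; first by rewrite mem_set.
by rewrite memNset//= => E; rewrite E eqxx in ba.
Qed.

Lemma unif_bool_invariant : Defs.invariant flip_kernel unif_bool.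
Proof.
move=> A _.
under eq_integral do rewrite flip_kernelE.
rewrite integral_borel_bool !unif_boolE -!EFinM -EFinD; congr (_%:E).
by rewrite !indic_borel_bool1/=; lra.
Qed.

Lemma unif_bool_unique (mu : probability bX R) : p < 1 ->
  Defs.invariant flip_kernel mu -> forall A, measurable A -> mu A = unif_bool A.
Proof.
move=> p1 imu A _.
pose m b : R := fine (mu [set b]).
have mE b : mu [set b] = (m b)%:E by rewrite fineK// borel_bool_fin.
have m1 : m true + m false = 1.
  have := borel_bool_split mu setT; rewrite probability_setT.
  by rewrite !mE !indicT !mule1 -EFinD => -[->].
have := imu [set true] (measurable_borel_bool _).
under eq_integral do rewrite flip_kernelE.
rewrite integral_borel_bool !mE -!EFinM -EFinD => -[].
rewrite !indic_borel_bool1/= => E.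
(* Invariance at [true] reads [m true = p * m true + (1 - p) * m false]; with [p < 1] and total mass
   1, both masses are one half. *)
have : (1 - p) * (m true - m false) = 0 by lra.
move/eqP; rewrite mulf_eq0 subr_eq0 (gt_eqF p1)/= => /eqP mm.
rewrite borel_bool_split !mE unif_boolE -!EFinM -EFinD.
by congr (_ * _ + _ * _)%:E; lra.
Qed.

(** Since [p <= 1 - p], one step charges each point with mass at least [p], and so dominates [p]
    times the uniform law from every starting point. *)
Lemma flip_kernel_small (A : set bX) : 0 < p <= 2^-1 -> small flip_kernel A.
Proof.
move=> /andP[p0 p2]; split; first exact: measurable_borel_bool.
exists 1%N, p, unif_bool; split => // x B _ mB.
rewrite /= (_ : (fun y => _) = (fun y => (\1_B y)%:E)); last first.
  by apply/funext => y; rewrite diracE indicE.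
rewrite integral_indic// setIT flip_kernelE unif_boolE -EFinM lee_fin.
rewrite !indicE; case: x => /=.
  by do 2! case: (_ \in B) => /=; lra.
by do 2! case: (_ \in B) => /=; lra.
Qed.

End flip_chain.

(** * The chain and its inputs *)

Section flip_chain_law.
Context d (T : measurableType d) (R : realType) (Q : probability T R) (p : R).
Context (Z : nat -> T -> bool).
Hypothesis HZ : bernoulli_process Q p Z.

Local Notation X := (bool : completePseudoMetricType R).
Local Notation bX := (borel X).
Local Notation Omg := (bX * T * T)%type.
Implicit Type mu : probability bX R.

(** A sample consists of an initial state, a point driving the flips and a point driving the inputs;
    only the first factor depends on the initial law. *)
Definition chain_law (mu : probability bX R) : probability Omg R :=
  ((mu \x Q) \x Q)%E.

Definition chain (k : nat) (w : Omg) : bX :=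
  foldl step (w.1.1 : bool) (outcomes Z k w.1.2).

Definition chain_input (k : nat) (w : Omg) : bool := Z k w.2.

Lemma chain_step k w : chain k.+1 w = step (chain k w) (Z k w.1.2).
Proof. by rewrite /chain /outcomes mkseqS foldl_rcons. Qed.

Lemma measurable_past k (S : set (bX * seq bool)) :
  measurable ([set v | S (v.1, outcomes Z k v.2)] : set (bX * T)).
Proof.
have -> : [set v : bX * T | S (v.1, outcomes Z k v.2)] =
    \bigcup_(b in [set: bX]) ([set b] `*` [set t | S (b, outcomes Z k t)]).
  apply/seteqP; split => -[b t] /=; first by exists b.
  by move=> [b' _ [/= -> ]].
apply: fin_bigcup_measurable; first exact: finite_finset.
move=> b _; apply: measurableX; first exact: measurable_borel_bool.
exact: (measurable_outcomes HZ k [set s | S (b, s)]).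
Qed.

Lemma measurable_past_present k (S : set (bX * seq bool)) (B : set bool) :
  measurable [set v : bX * T | S (v.1, outcomes Z k v.2) /\ B (Z k v.2)].
Proof.
apply: measurableI; first exact: measurable_past.
have := @measurable_snd _ _ bX T measurableT _
  (measurable_bernoulli_process_set HZ k B).
by rewrite setTI.
Qed.

Lemma chain_lawE mu (E : set (bX * T)) (F : set T) :
  measurable E -> measurable F ->
  chain_law mu [set w | E w.1 /\ F w.2] = ((mu \x Q) E * Q F)%E.
Proof. exact: product_measure1E. Qed.

Lemma chain_law_past mu (E : set (bX * T)) : measurable E ->
  chain_law mu [set w | E w.1] = (mu \x Q)%E E.
Proof.
move=> mE; rewrite -[RHS]mule1 -(probability_setT Q) -chain_lawE//.
by congr (chain_law mu _); apply/seteqP; split => w //= [].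
Qed.

Lemma chain_law_input mu (F : set T) : measurable F ->
  chain_law mu [set w | F w.2] = Q F.
Proof.
move=> mF; rewrite -[RHS]mul1e -(probability_setT (mu \x Q)%E) -chain_lawE//.
by congr (chain_law mu _); apply/seteqP; split => w //= [].
Qed.

(** Once the initial state is fixed, this is independence of trial [k] from the earlier ones; the
    two possible initial states are then summed. *)
Lemma past_indep mu k (S : set (bX * seq bool)) (B : set bool) :
  (mu \x Q)%E [set v | S (v.1, outcomes Z k v.2) /\ B (Z k v.2)] =
  ((mu \x Q)%E [set v | S (v.1, outcomes Z k v.2)] * Q [set t | B (Z k t)])%E.
Proof.
have mB := measurable_bernoulli_process_set HZ k B.
have mfst b : measurable [set v : bX * T | v.1 = b].
  rewrite (_ : [set v : bX * T | v.1 = b] = [set b] `*` setT).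
    by apply: measurableX => //; exact: measurable_borel_bool.
  by apply/seteqP; split => -[? ?] //= [].
have mE := measurable_past_present k S B.
pose P : probability (bX * T)%type R := (mu \x Q)%E.
have PX A F : measurable A -> measurable F -> P (A `*` F) = (mu A * Q F)%E.
  exact: product_measure1E.
rewrite -!/(P _) (probability_split P mfst mE).
rewrite (probability_split P mfst (measurable_past k S)).
rewrite ge0_sume_distrl//; apply: eq_bigr => b _.
rewrite (_ : _ `&` _ =
    [set b] `*` [set t | S (b, outcomes Z k t) /\ B (Z k t)]); last first.
  by apply/seteqP; split => -[b' t] /= => [[[? ?] <-]|[-> []]].
rewrite (_ : [set v : bX * T | S _] `&` _ =
    [set b] `*` [set t | S (b, outcomes Z k t)]); last first.
  by apply/seteqP; split => -[b' t] /= => [[? <-]|[->]].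
rewrite !PX; last 4 first.
- exact: measurable_borel_bool.
- exact: (measurable_outcomes HZ k [set s | S (b, s)]).
- exact: measurable_borel_bool.
- apply: measurableI => //.
  exact: (measurable_outcomes HZ k [set s | S (b, s)]).
by rewrite (outcomes_indep_set HZ k [set s | S (b, s)]) muleA.
Qed.

Lemma bernoulli_process_law_set k (B : set bool) :
  Q [set t | B (Z k t)] = bernoulli_prob p B.
Proof.
rewrite (probability_split Q (measurable_bernoulli_process HZ k)
  (measurable_bernoulli_process_set HZ k B)).
rewrite bernoulli_probE ?(bernoulli_process_param HZ)// big_bool/=.
have H b : Q ([set t | B (Z k t)] `&` [set t | Z k t = b]) =
   ((bernoulli_pmf p b)%:E * \d_b B)%E.
  rewrite diracE; have [Bb|Bb] := pselect (B b).
    rewrite mem_set// mule1 -(bernoulli_process_law HZ k b); congr (Q _).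
    by apply/seteqP; split => t /= => [[]|E]//; rewrite E.
  rewrite memNset// mule0 -(measure0 Q); congr (Q _).
  by apply/seteqP; split => t //= [+ E]; rewrite E.
by rewrite !H.
Qed.

Lemma measurable_chain k : measurable_fun setT (chain k).
Proof.
move=> _ B _; rewrite setTI.
rewrite (_ : chain k @^-1` B =
  [set v : bX * T | B (foldl step (v.1 : bool) (outcomes Z k v.2))] `*` setT).
  apply: measurableX => //.
  exact: (measurable_past k [set u | B (foldl step (u.1 : bool) u.2)]).
by apply/seteqP; split => w //= [].
Qed.

Lemma measurable_chain_input k : measurable_fun setT (chain_input k).
Proof.
move=> _ B _; rewrite setTI.
rewrite (_ : chain_input k @^-1` B = setT `*` [set t | B (Z k t)]).
  by apply: measurableX => //; exact: (measurable_bernoulli_process_set HZ).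
by apply/seteqP; split => w //= [].
Qed.

Lemma chain_init mu (A : set bX) : measurable A ->
  chain_law mu (chain 0 @^-1` A) = mu A.
Proof.
move=> mA; rewrite -[RHS]mule1 -(probability_setT Q) -product_measure1E//.
rewrite -chain_law_past; last exact: measurableX.
by congr (chain_law mu _); apply/seteqP; split => w //= [].
Qed.

(** The events determined by the initial state and the first [k] flips form a sigma-algebra, which
    contains the generators because the state at time [j <= k] is computed from the first [j]
    flips. *)
Lemma chain_history k (H : set Omg) : history chain k H ->
  exists S : set (bX * seq bool), H = [set w | S (w.1.1, outcomes Z k w.1.2)].
Proof.
pose f (w : Omg) := (w.1.1, outcomes Z k w.1.2).
have : sigma_algebra setT (preimage_set_system setT f setT).
  by apply: sigma_algebra_preimage; split.
move=> /smallest_sub hs /(hs _) [|S _ <-]; last by exists S; rewrite setTI.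
move=> _ [j /= jk [A _ <-]].
exists [set u | A (foldl step (u.1 : bool) (take j u.2))] => //.
rewrite !setTI; apply/seteqP; split => w /=; rewrite /f /chain/=.
  by rewrite /outcomes /mkseq -map_take take_iota (minn_idPl _).
by rewrite /outcomes /mkseq -map_take take_iota (minn_idPl _).
Qed.

(** Given the current state [b], the next state is a function of the fresh flip [Z k], which is
    independent of the past. *)
Lemma chain_markov mu k H (A : set bX) : history chain k H -> measurable A ->
  (chain_law mu (H `&` chain k.+1 @^-1` A) =
   \int[chain_law mu]_(w in H) flip_kernel p (chain k w) A)%E.
Proof.
move=> /chain_history[S HS] mA.
have mch b : measurable [set w | chain k w = b].
  rewrite -[X in measurable X]setTI.
  exact: (measurable_chain k measurableT (measurable_borel_bool [set b])).
have mH : measurable H.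
  rewrite HS (_ : [set w : Omg | _] =
     [set v : bX * T | S (v.1, outcomes Z k v.2)] `*` setT).
    by apply: measurableX => //; exact: measurable_past.
  by apply/seteqP; split => w //= [].
have mHA : measurable (H `&` chain k.+1 @^-1` A).
  apply: measurableI => //; rewrite -[X in measurable X]setTI.
  exact: (measurable_chain k.+1 measurableT mA).
pose g (b : bool) := p * \1_A (b : bX) + (1 - p) * \1_A (~~ b : bX).
rewrite (eq_integral (fun w => (g (chain k w))%:E)); last first.
  by move=> w _; rewrite (flip_kernelE HZ).
rewrite (integral_finite_valued _ mch)//.
rewrite (probability_split _ mch)//; apply: eq_bigr => b _.
(* The condition that the current state is [b] is itself a past event and is absorbed into [S]. *)
pose S' : set (bX * seq bool) :=
  [set u | S u /\ foldl step (u.1 : bool) u.2 = b].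
rewrite (_ : H `&` [set w | chain k w = b] =
  [set w | S' (w.1.1, outcomes Z k w.1.2)]); last by rewrite HS.
rewrite (_ : _ `&` _ = [set w : Omg | S' (w.1.1, outcomes Z k w.1.2) /\
    (step b @^-1` A) (Z k w.1.2)]); last first.
  rewrite HS; apply/seteqP; split => w /=.
    move=> [[Sw Aw] cw]; split; first by split.
    by rewrite -cw -chain_step.
  move=> [[Sw cw] Aw]; split => //; split => //.
  by rewrite chain_step /chain cw.
rewrite (chain_law_past mu
  (E := [set v : bX * T | S' (v.1, outcomes Z k v.2) /\
    (step b @^-1` A) (Z k v.2)])); last exact: measurable_past_present.
rewrite (chain_law_past mu (measurable_past k S')) past_indep.
by rewrite bernoulli_process_law_set -(flip_kernelE HZ) muleC.
Qed.

Lemma chain_input_law mu k A :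
  chain_law mu (chain_input k @^-1` A) = bernoulli_prob p A.
Proof.
rewrite -(bernoulli_process_law_set k) -(chain_law_input mu)//.
exact: (measurable_bernoulli_process_set HZ).
Qed.

Lemma chain_input_independent mu :
  mutually_independent (chain_law mu) chain_input.
Proof.
move=> J A Ju mA.
transitivity (Q (\bigcap_(j in [set` J]) (Z j @^-1` A j))).
  rewrite -(chain_law_input mu)//.
  apply: fin_bigcap_measurable => //.
  by move=> j _; exact: (measurable_bernoulli_process_set HZ).
rewrite (bernoulli_process_independent HZ Ju mA).
apply: eq_bigr => j _; rewrite chain_input_law.
exact: bernoulli_process_law_set.
Qed.

(** The inputs depend on the last coordinate and the chain on the other two, and the law is a
    product. *)
Lemma chain_input_chain_indep mu A B :
  sigma_process chain_input A -> sigma_process chain B ->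
  (chain_law mu (A `&` B) = chain_law mu A * chain_law mu B)%E.
Proof.
have sA : sigma_process chain_input `<=`
    preimage_set_system setT (snd : Omg -> T) measurable.
  apply: smallest_sub.
    by apply: sigma_algebra_preimage; exact: sigma_algebra_measurable.
  move=> _ [j _ [C _ <-]]; exists [set t | C (Z j t)] => //.
  exact: (measurable_bernoulli_process_set HZ).
have sB : sigma_process chain `<=`
    preimage_set_system setT (fst : Omg -> bX * T) measurable.
  apply: smallest_sub.
    by apply: sigma_algebra_preimage; exact: sigma_algebra_measurable.
  move=> _ [j _ [C _ <-]].
  exists [set v | C (foldl step (v.1 : bool) (outcomes Z j v.2))] => //.
  exact: (measurable_past j [set u | C (foldl step (u.1 : bool) u.2)]).
move=> /sA[F mF <-] /sB[E mE <-]; rewrite !setTI.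
rewrite setIC (chain_lawE mu mE mF) (chain_law_past mu mE).
by rewrite (chain_law_input mu mF) muleC.
Qed.

End flip_chain_law.

(** * Linear differential equations *)

Lemma is_derive_expRM (R : realType) (a t : R) :
  is_derive t 1 (fun s : R => expR (a * s)) (a * expR (a * t)).
Proof.
have d1 : is_derive t 1 (a \*: (id : R -> R)) (a *: (1 : R)).
  by apply: is_deriveZ; exact: is_derive_id.
have d2 := is_derive1_comp (is_derive_expR (a * t)) d1.
by apply: (is_derive_eq d2); rewrite scaler1 mulrC.
Qed.

Section linear_ode.
Context (R : realType) (n : nat) (a : R).

Lemma linear_ode_ex (v0 : 'cV[R]_n) :
  ode_solution (fun v => a *: v) v0 (fun t => expR (a * t) *: v0).
Proof.
have D (t : R) : is_derive t 1 (fun t : R => expR (a * t) *: v0)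
    (a *: (expR (a * t) *: v0)).
  have dE i j : is_derive t 1 (fun t : R => (expR (a * t) *: v0) i j)
      (a * (expR (a * t) * v0 i j)).
    have -> : (fun t : R => (expR (a * t) *: v0) i j) =
        v0 i j \*: (fun s => expR (a * s)).
      by apply/funext => s; rewrite !mxE mulrC.
    apply: (is_derive_eq (is_deriveZ (v0 i j) (is_derive_expRM a t))).
    by rewrite /GRing.scale/=; ring.
  have dv : derivable (fun t : R => expR (a * t) *: v0) t 1.
    by apply/derivable_mxP => i j; have [] := dE i j.
  apply: DeriveDef => //; apply/matrixP => i j.
  rewrite derive_mx// !mxE.
  by have [_] := dE i j.
split => //; first by rewrite mulr0 expR0 scale1r.
apply: continuous_subspaceT => t; apply: differentiable_continuous.
by apply/derivable1_diffP; have [] := D t.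
Qed.

(** Each coordinate multiplied by the integrating factor [expR (- a * s)] has zero derivative at
    positive times and is continuous up to 0, so the mean value theorem makes it constant. *)
Lemma linear_ode_unique (v0 : 'cV[R]_n) (v : R -> 'cV[R]_n) :
  ode_solution (fun v => a *: v) v0 v ->
  forall t, 0 <= t -> v t = expR (a * t) *: v0.
Proof.
move=> [v00 vc dv] t; rewrite le_eqVlt => /predU1P[<-|t0].
  by rewrite mulr0 expR0 scale1r.
apply/matrixP => i j; rewrite ord1 mxE {j}.
have vi (s : R) : 0 < s -> is_derive s 1 (fun r : R => v r i 0) (a * v s i 0).
  move=> s0; have [vd vE] := dv s s0.
  apply: DeriveDef; first by move/derivable_mxP : vd; exact.
  by move/matrixP : vE => /(_ i 0); rewrite derive_mx// !mxE.
pose w (s : R) := expR (- a * s) * v s i 0.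
have wd (s : R) : s \in `]0, t[ -> is_derive s 1 w 0.
  rewrite in_itv/= => /andP[s0 _].
  have d1 := is_derive_expRM (- a) s.
  apply: (is_derive_eq (is_deriveM d1 (vi s s0))).
  by rewrite /GRing.scale/=; ring.
have wc : {within `[0, t], continuous w}.
  have vt : {within `[0, t], continuous v}.
    by apply: continuous_subspaceW vc; exact: subset_itvl.
  have et : {within `[0, t], continuous (fun s : R => expR (- a * s))}.
    apply: continuous_subspaceT => s; apply: differentiable_continuous.
    by apply/derivable1_diffP; have [] := is_derive_expRM (- a) s.
  move=> s; apply: cvgM; first exact: et.
  apply: (@continuous_comp _ _ _ (v : subspace `[0, t] -> 'cV[R]_n)
    (fun M : 'cV[R]_n => M i 0)); first exact: vt.
  exact: coord_continuous.
have [c _] := MVT t0 wd wc.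
rewrite mul0r /w mulr0 expR0 mul1r v00 => /eqP; rewrite subr_eq0 => /eqP <-.
by rewrite mulrA -expRD mulNr subrr expR0 mul1r.
Qed.

Lemma linear_ode_diverges (v0 : 'cV[R]_n) (v : R -> 'cV[R]_n) : 0 < a ->
  v0 != 0 -> ode_solution (fun v => a *: v) v0 v -> diverges v.
Proof.
move=> a0 v00 /linear_ode_unique vE.
have e0 : 0 < enorm v0.
  rewrite sqrtr_gt0 lt_neqAle sumr_ge0 ?andbT; last first.
    by move=> i _; exact: sqr_ge0.
  apply: contra v00 => /eqP/esym s0; apply/eqP/matrixP => i j.
  rewrite ord1 mxE; apply/eqP; rewrite -sqrf_eq0.
  by rewrite (psumr_eq0P _ s0)// => k _; exact: sqr_ge0.
have E t : 0 <= t -> enorm (v t) = expR (a * t) * enorm v0.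
  move=> t0; rewrite vE// /enorm.
  under eq_bigr do rewrite mxE exprMn.
  by rewrite -mulr_sumr sqrtrM ?sqr_ge0// sqrtr_sqr ger0_norm// expR_ge0.
(* As [1 + a * t <= expR (a * t)], the norm is at least [a * t * enorm v0], which exceeds [A] beyond
   this time. *)
apply/cvgryPge => A; exists (Num.max 0 (A / enorm v0 / a)).
split; first exact: num_real.
move=> t; rewrite gt_max => /andP[/ltW t0 /ltW At].
rewrite E//; apply: (@le_trans _ _ ((1 + a * t) * enorm v0)); last first.
  by rewrite ler_pM2r// expR_ge1Dx.
rewrite -ler_pdivrMr// (le_trans (y := a * t))//; last by rewrite lerDr.
by rewrite (mulrC a) -ler_pdivrMr.
Qed.

End linear_ode.

(** * The model *)

(** The sets with Borel preimage form a sigma-algebra, and continuity puts the open sets in it. *)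
Lemma continuous_borel_fun (T T' : topologicalType) (f : T -> T') :
  continuous f -> borel_fun f.
Proof.
move=> cf B.
have /smallest_sub : sigma_algebra setT
    (image_set_system setT f <<s @open T >>).
  by apply: sigma_algebra_image; exact: smallest_sigma_algebra.
move=> /(_ (@open T')) h /h; rewrite /image_set_system/= setTI; apply.
move=> U oU; rewrite /image_set_system/= setTI; apply: sub_sigma_algebra.
by move/continuousP : cf; exact.
Qed.

Section flip_model.
Context d (T : measurableType d) (R : realType) (Q : probability T R) (p : R).
Context (Z : nat -> T -> bool).
Hypothesis HZ : bernoulli_process Q p Z.
Hypothesis p_lt1 : p < 1.

Local Notation X := (bool : completePseudoMetricType R).
Local Notation bX := (borel X).

Definition sgn (x : bool) : R := if x then 1 else - 1.

(** The Euclidean subset is the whole line, seen as a subtype; [mem_set I] is the trivial membership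
    proof. *)
Definition sgn_state (x : X) : [set: 'cV[R]_1] :=
  exist _ (const_mx (sgn x)) (mem_set I).

Definition basis0 (s : [set: 'cV[R]_1]) : 'cV[R]_1 := set_val s.

Definition basis1 (s : [set: 'cV[R]_1]) : 'cV[R]_1 := (- 10) *: set_val s.

Lemma borel_fun_sgn_state : borel_fun sgn_state.
Proof. by move=> B _; exact: measurable_borel_bool. Qed.

Lemma continuous_basis0 : continuous basis0.
Proof. exact: initial_continuous. Qed.

Lemma borel_fun_basis0 : borel_fun basis0.
Proof. exact: (continuous_borel_fun continuous_basis0). Qed.

Lemma borel_fun_basis1 : borel_fun basis1.
Proof.
apply: continuous_borel_fun => s.
exact: (cvgZ (cvg_cst _) (continuous_basis0 (x := s))).
Qed.

(** The observation is the state itself, so an event about the current state is already a generator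
    of the history. *)
Lemma sgn_state_adapted k (B : set [set: 'cV[R]_1]) :
  <<s @open [set: 'cV[R]_1] >> B ->
  history (fun j w => (id : bX -> bX) (chain Z j w)) k
    [set w | B (sgn_state (chain Z k w))].
Proof.
move=> _; apply: sub_sigma_algebra; exists k => //=.
exists (sgn_state @^-1` B); first exact: measurable_borel_bool.
by rewrite setTI.
Qed.

Lemma half_gt0 : 0 < 2^-1 :> R. Proof. by lra. Qed.

Lemma half_lt1 : 2^-1 < 1 :> R. Proof. by lra. Qed.

(** Only the proof fields are written; the spaces, kernel, laws, zero costs and discount one half
    are inferred from their types. *)
Definition flip_model : model R := {|
  Xspace_polish := polish_bool R;
  Yspace_polish := polish_bool R;
  varpi_invariant := unif_bool_invariant HZ;
  varpi_unique := fun mu => @unif_bool_unique _ _ _ _ _ _ HZ mu p_lt1;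
  Phi_measurable := measurable_chain HZ;
  Phi_init := @chain_init _ _ _ Q Z;
  Phi_markov := @chain_markov _ _ _ _ _ _ HZ;
  obs_measurable := @measurable_fun_borel_bool _ _ bX id;
  surrogate_measurable := borel_fun_sgn_state;
  surrogate_adapted := sgn_state_adapted;
  input_measurable := measurable_chain_input HZ;
  c_circ_measurable := @measurable_cst _ _ bX R setT 0;
  c_bullet_measurable := @measurable_cst _ _ bX R setT 0;
  discount_gt0 := half_gt0;
  discount_lt1 := half_lt1;
  bdim_gt0 := ltn0Sn 0;
  psi0_measurable := borel_fun_basis0;
  psi1_measurable := borel_fun_basis1
|}.
End flip_model.

(** * The mean flow *)

Section flip_model_theory.
Context d (T : measurableType d) (R : realType) (Q : probability T R) (p : R).
Context (Z : nat -> T -> bool).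
Hypothesis HZ : bernoulli_process Q p Z.

Local Notation X := (bool : completePseudoMetricType R).
Local Notation bX := (borel X).

(** The update at time 0 sees only the initial state, the first flip and the first input, so its
    expectation is a sum of eight terms. *)
Lemma chain_expectation (mu : probability bX R)
    (g : bool -> bool -> bool -> R) :
  fine ('E_(chain_law Q mu)[fun w => g w.1.1 (Z 0 w.1.2) (Z 0 w.2)]) =
  \sum_(x : bool) \sum_(z : bool) \sum_(u : bool)
    g x z u * (fine (mu [set x]) * bernoulli_pmf p z * bernoulli_pmf p u).
Proof.
pose V := (bool * bool * bool)%type.
pose Y (w : bX * T * T) : V := (w.1.1 : bool, Z 0 w.1.2, Z 0 w.2).
pose h (v : V) := g v.1.1 v.1.2 v.2.
have YE v : [set w | Y w = v] =
    [set w | ([set v.1.1] `*` [set t | Z 0 t = v.1.2]) w.1 /\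
             [set t | Z 0 t = v.2] w.2].
  apply/seteqP; split => -[[x t] s] /=; case: v => -[x' z] u /=.
    by move=> [<- <- <-].
  by move=> [[<- <-] <-].
have mZ := measurable_bernoulli_process HZ 0.
have mX z : measurable ([set z.1] `*` [set t | Z 0 t = z.2] : set (bX * T)).
  by apply: measurableX => //; exact: measurable_borel_bool.
have mY v : measurable [set w | Y w = v].
  rewrite YE (_ : [set w | _] = ([set v.1.1] `*` [set t | Z 0 t = v.1.2]) `*`
    [set t | Z 0 t = v.2]); last by apply/seteqP; split.
  exact: (measurableX (mX v.1) (mZ v.2)).
have PY v : chain_law Q mu [set w | Y w = v] =
   (fine (mu [set v.1.1]) * bernoulli_pmf p v.1.2 * bernoulli_pmf p v.2)%:E.
  rewrite YE (chain_lawE Q mu (mX v.1) (mZ v.2)).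
  have -> : (mu \x Q)%E ([set v.1.1] `*` [set t | Z 0 t = v.1.2]) =
     (mu [set v.1.1] * Q [set t | Z 0 t = v.1.2])%E.
    by apply: product_measure1E => //; exact: measurable_borel_bool.
  rewrite !(bernoulli_process_law HZ) !EFinM fineK//.
  exact: borel_bool_fin.
rewrite unlock (integral_finite_valued (chain_law Q mu) mY h)//.
under eq_bigr do rewrite setTI PY -EFinM.
rewrite sumEFin/=.
rewrite [in RHS]pair_bigA/= pair_bigA/=.
by [].
Qed.

Hypothesis p_lt1 : p < 1.

Let M := flip_model HZ p_lt1.

(** The factor [9 / 4] is [9 / 2] times the discount [1 / 2]; the subtracted [100 * p + (1 - p)] is
    the second moment of the basis. *)
Definition growth_rate : R :=
  9 / 4 * (1 - p) * (1 - p *+ 2) - 100 * p - (1 - p).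

Lemma flip_psiE (x u : bool) : psi (M := M) (sgn_state x) u 0 0 =
  if u then - 10 * sgn R x else sgn R x.
Proof.
rewrite /psi/= /basis0 /basis1 !mxE.
by case: u => /=; ring.
Qed.

Lemma flip_QfunE (theta : 'cV[R]_1) (x u : bool) :
  Qfun (M := M) theta (sgn_state x) u =
  theta 0 0 * if u then - 10 * sgn R x else sgn R x.
Proof.
by rewrite /Qfun mxE big_ord_recl big_ord0 addr0 mxE flip_psiE.
Qed.

(** This is the scalar update with parameter [a], state [x], flip [z] and input [u]. *)
Definition flip_td (a : R) (x z u : bool) : R :=
  let b := if u then - 10 * sgn R x else sgn R x in
  let s := sgn R (step x z) in
  (- (a * b) + 2^-1 * (1 - u%:R) * Num.min (a * s) (a * (- 10 * s))) * b.

Lemma flip_updateE (theta : 'cV[R]_1) (w : Omega M) :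
  update (M := M) 0 theta w 0 0 =
  flip_td (theta 0 0) w.1.1 (Z 0 w.1.2) (Z 0 w.2).
Proof.
rewrite /update mxE /state /Qmin /=.
rewrite !flip_QfunE flip_psiE /cost/= /cst/= /chain_input.
by rewrite !mulr0 !addr0.
Qed.

Lemma unif_bool1 b : fine (unif_bool R [set b]) = 2^-1.
Proof.
by rewrite unif_boolE !indic_borel_bool1; case: b => /=; lra.
Qed.

Lemma flip_mean_flow (theta : 'cV[R]_1) :
  mean_flow (M := M) theta = growth_rate *: theta.
Proof.
apply/matrixP => i j; rewrite !ord1 [RHS]mxE /mean_flow /expectation_mx mxE.
transitivity (fine ('E_(chain_law Q (unif_bool R))[fun w =>
   flip_td (theta 0 0) w.1.1 (Z 0 w.1.2) (Z 0 w.2)])).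
  by congr (fine (expectation _ _)); apply/funext => w; rewrite flip_updateE.
rewrite chain_expectation !big_bool !unif_bool1 /flip_td /=.
set a := theta 0 0; rewrite /growth_rate.
(* The sign of [a] decides each minimum, yet in both cases the minimum at state 1 minus that at
   state -1 is [- 9 * a], which makes the result linear. *)
have [a0|a0] := leP 0 a.
  rewrite (_ : Num.min (a * 1) (a * (-10 * 1)) = -10 * a); last first.
    by rewrite min_r; lra.
  rewrite (_ : Num.min (a * -1) (a * (-10 * -1)) = - a); last first.
    by rewrite min_l; lra.
  by field.
rewrite (_ : Num.min (a * 1) (a * (-10 * 1)) = a); last first.
  by rewrite min_l; lra.
rewrite (_ : Num.min (a * -1) (a * (-10 * -1)) = 10 * a); last first.
  by rewrite min_r; lra.
by field.
Qed.

(** * Autocorrelation, instability, inputs, drift and growth *)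

Lemma flip_autocorrelation :
  autocorrelation M = const_mx (100 * p + (1 - p)).
Proof.
apply/matrixP => i j; rewrite !ord1 [RHS]mxE /autocorrelation /expectation_mx.
rewrite mxE; pose b (x u : bool) := if u then - 10 * sgn R x else sgn R x.
transitivity (fine ('E_(chain_law Q (unif_bool R))[fun w =>
   (fun x _ u => b x u ^+ 2) w.1.1 (Z 0 w.1.2) (Z 0 w.2)])).
  congr (fine (expectation _ _)); apply/funext => w /=.
  rewrite mxE big_ord_recl big_ord0 addr0 [X in _ * X]mxE.
  by rewrite /state/= flip_psiE expr2.
rewrite (chain_expectation _ (fun x _ u => b x u ^+ 2)).
rewrite !big_bool !unif_bool1 /b /=.
by field.
Qed.

Lemma flip_autocorrelation_rank : \rank (autocorrelation M) = bdim M.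
Proof.
apply: mxrank_unit; rewrite unitmxE det_mx11 flip_autocorrelation mxE unitfE.
have /andP[p0 _] := bernoulli_process_param HZ.
apply: lt0r_neq0; lra.
Qed.

Lemma flip_not_separable : ~ separable_basis M.
Proof.
(* At state 1 the two basis values are 1 and -10. *)
move=> /(_ (sgn_state true) 0); rewrite /= /basis0 /basis1 !mxE /=; lra.
Qed.

Lemma flip_unstable : 0 < growth_rate -> unstable_mean_flow M.
Proof.
move=> l0; have fE : mean_flow (M := M) = fun theta => growth_rate *: theta.
  by apply/funext => theta; exact: flip_mean_flow.
exists 0; rewrite fE; split; first by rewrite scaler0.
  by move=> theta /eqP; rewrite scaler_eq0 gt_eqF//= => /eqP.
move=> v0 v00; split.
  by exists (fun t => expR (growth_rate * t) *: v0); exact: linear_ode_ex.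
by move=> v; apply: linear_ode_diverges.
Qed.

Lemma flip_iid : iid_input M.
Proof.
exists (bernoulli_prob p) => mu; split.
- by move=> k A; exact: (chain_input_law HZ).
- exact: (chain_input_independent HZ).
- by move=> A B; exact: (chain_input_chain_indep HZ).
Qed.

Lemma flip_drift : 0 < p <= 2^-1 ->
  drift (M := M) (fun=> 0) (fun=> 1).
Proof.
move=> p02; split => //.
(* With [V = 0] and [W = 1], the choice [b = 1] turns both sides into 1. *)
- exists 1 => // x; rewrite integral_cst//= probability_setT mule1.
  by rewrite sub0r addNr expR0.
- move=> r r0; split; first by left; exact: (flip_kernel_small HZ).
  by exists 0 => _ [y _ <-].
Qed.

Lemma flip_little_o : little_o_of (Gfun M) (fun=> 1).
Proof.
pose C := Num.max `|Gfun M true| `|Gfun M false|.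
(* With two states, [C] bounds the absolute value of [Gfun M], and for [r > 1] the denominator is
   [r]. *)
apply: (@squeeze_cvge _ _ _ _ (fun=> 0%E) _ (fun r => (C * r^-1)%:E)).
- exists 1; split => // r r1; apply/andP; split.
    apply: (@le_trans _ _ (`|Gfun M true| / Num.max r 1)%:E).
      by rewrite lee_fin divr_ge0// le_max ler01 orbT.
    by apply: ereal_sup_ubound; exists true.
  apply: ge_ereal_sup => _ [x _ <-].
  have r0 : 0 < r by exact: lt_trans r1.
  rewrite lee_fin; have -> : Num.max r 1 = r by apply/max_idPl/ltW.
  rewrite ler_pM2r ?invr_gt0// le_max.
  by case: x => /=; rewrite lexx ?orbT.
- exact: cvg_cst.
- apply: cvg_EFin; first by near=> r.
  rewrite -[X in _ --> X](mulr0 C); apply: cvgM; first exact: cvg_cst.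
  by apply/gtr0_cvgV0; [near=> r|exact: cvg_id].
Unshelve. all: by end_near. Qed.

End flip_model_theory.

Theorem proposition2p3 (R : realType) :
  exists (M : model R) (alpha : nat -> R)
         (theta : nat -> Omega M -> 'cV[R]_(bdim M)) (V W : Xspace M -> R),
    q_learning alpha theta /\
    step_size alpha /\
    iid_input M /\
    drift V W /\
    little_o_of (Gfun M) W /\
    \rank (autocorrelation M) = bdim M /\
    ~ separable_basis M /\
    unstable_mean_flow M.
Proof.
(* Base 100 gives [p = 1 / 100], for which the growth rate is about 0.19. *)
have HZ : bernoulli_process _ _ _ := @zero_digit_bernoulli R 100 isT.
have p1 : 100^-1 < 1 :> R by lra.
pose M := flip_model HZ p1.
(* The step sizes use [alpha0 = 1] and [rho = 1], and the recursion starts from 0. *)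
pose alpha (n : nat) : R := Num.min 1 (n%:R `^ (- 1)).
pose theta := fix theta n (w : Omega M) : 'cV[R]_(bdim M) :=
  if n is m.+1 then theta m w + alpha m.+1 *: update m (theta m w) w else 0.
exists M, alpha, theta, (fun=> 0), (fun=> 1).
split; first by [].
split; first by exists 1, 1; split => //; lra.
split; first exact: flip_iid.
split; first by apply: flip_drift; lra.
split; first exact: flip_little_o.
split; first exact: flip_autocorrelation_rank.
split; first exact: flip_not_separable.
by apply: flip_unstable; rewrite /growth_rate; lra.
Qed.
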